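(* Let $\lambda=(\lambda_1,\dots,\lambda_l)$ be a partition of $n$ and let $1\le i\le l+1$ be such that $\lambda+\vec e_i=(\lambda_1,\dots,\lambda_{i-1},\lambda_i+1,\lambda_{i+1},\dots,\lambda_l)$ is a partition of $n+1$ (with $\lambda_{l+1}=0$). Let $\mathcal L_i^\lambda:S^\lambda\to S^{\lambda+\vec e_i}$ be the composition of the restriction of $\operatorname{sh}_i$ to $S^\lambda$ (which maps into $M^{\lambda+\vec e_i}$) with the orthogonal projection $M^{\lambda+\vec e_i}\to S^{\lambda+\vec e_i}$. Then: (a) if $v\in S^\lambda$ is an eigenvector of $\mathrm{R2R}_n$ with eigenvalue $\varepsilon$, then $\mathcal L_i^\lambda(v)$, if nonzero, is an eigenvector of $\mathrm{R2R}_{n+1}$ with eigenvalue $\varepsilon+(n+1)+(\lambda_i+1)-i$; (b) $$\mathcal L_i^\lambda=\sum_{1\le b_1<\dots<b_t<b_{t+1}=i}\Big(\prod_{j=1}^{t}\frac{1}{(\lambda_i-i)-(\lambda_{b_j}-b_j)}\Big)\,\Theta_{b_t,b_{t+1}}\circ\Theta_{b_{t-1},b_t}\circ\cdots\circ\Theta_{b_1,b_2}\circ\operatorname{sh}_{b_1}\Big|_{S^\lambda},$$ the sum being over all $t\ge 0$ and all strictly increasing sequences $b_1<\dots<b_{t+1}$ of positive integers ending at $b_{t+1}=i$.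
   Context: Words are finite sequences over the ordered alphabet $\{1,2,\dots,N\}$ ($N$ large enough). For a sequence $\alpha$ of nonnegative integers, $M^\alpha$ is the complex vector space with basis the words of evaluation $\alpha$ (containing $\alpha_k$ occurrences of letter $k$), and $M^{(n)}$ is the span of all words of length $n$; these carry the inner product for which words are orthonormal. For a letter $a$ and word $w=w_1\cdots w_n$: $\operatorname{sh}_a(w)=\sum_{j=0}^{n} w_1\cdots w_j\,a\,w_{j+1}\cdots w_n$; $\partial_a(w)=\sum_{k:\,w_k=a} w_1\cdots w_{k-1}w_{k+1}\cdots w_n$; $\Theta_{p,q}(w)=\sum_{k:\,w_k=p} w_1\cdots w_{k-1}\,q\,w_{k+1}\cdots w_n$; all extended linearly. $\mathrm{R2R}_n=\sum_{a}\operatorname{sh}_a\circ\partial_a$ on $M^{(n)}$ (i.e. $\mathrm{R2R}_n(w)$ is the sum over all ways of removing one letter of $w$ and reinserting it in one of the $n$ positions). Specht module: for a tableau $t$ of shape $\lambda\vdash n$ filled bijectively with $1,\dots,n$, $\operatorname{word}(t)$ is the word whose $k$-th letter is the index of the row of $t$ containing $k$; $\mathbf w_t=\sum_{\sigma\in\operatorname{ColStab}(t)}\operatorname{sign}(\sigma)\operatorname{word}(\sigma(t))$, where $\operatorname{ColStab}(t)$ is the group of permutations of $\{1,\dots,n\}$ preserving the set of entries of each column of $t$ and $\sigma(t)$ replaces each entry $x$ by $\sigma(x)$; $S^\lambda=\operatorname{span}\{\mathbf w_t: t \text{ standard of shape }\lambda\}\subseteq M^\lambda$. *)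

(* Defs.v *)
From HB Require Import structures.
From mathcomp Require Import all_boot all_order all_fingroup all_algebra.

Set Implicit Arguments.
Unset Strict Implicit.
Unset Printing Implicit Defensive.

Import Order.TTheory GRing.Theory Num.Theory.
Local Open Scope ring_scope.

(* MathComp.  Letters, row indices and positions all count from 0: the letter *)
(* k + 1 of the alphabet {1, ..., N} is the ordinal of value k in 'I_N.       *)

Definition is_partition (n : nat) (la : seq nat) : bool :=
  [&& sorted geq la, 0%N \notin la & sumn la == n].

Definition word (N n : nat) : finType := n.-tuple 'I_N.

(* The space M^(n): v w is the coefficient of the word w in v. *)
Definition wspace (C : numClosedFieldType) (N n : nat) : vectType C :=
  {ffun word N n -> C^o}.

Section Words.

Variables (C : numClosedFieldType) (N : nat).

Definition wvec n (w : word N n) : wspace C N n := [ffun w' => (w' == w)%:R].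

Definition linext m n (f : word N m -> wspace C N n) (v : wspace C N m) :
  wspace C N n := \sum_w v w *: f w.

Definition wdot n (u v : wspace C N n) : C := \sum_w u w * (v w)^*.

(* The word w_1 ... w_j a w_(j+1) ... w_n, in which a has position j. *)
Definition insert_at n (j : 'I_n.+1) (a : 'I_N) (w : word N n) : word N n.+1 :=
  [tuple if unlift j k is Some k' then tnth w k' else a | k < n.+1].

Definition delete_at n (j : 'I_n.+1) (w : word N n.+1) : word N n :=
  [tuple tnth w (lift j k) | k < n].

Definition replace_at n (j : 'I_n) (a : 'I_N) (w : word N n) : word N n :=
  [tuple if k == j then a else tnth w k | k < n].

Definition sh n (a : 'I_N) : wspace C N n -> wspace C N n.+1 :=
  linext (fun w => \sum_(j < n.+1) wvec (insert_at j a w)).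

Definition partial n (a : 'I_N) : wspace C N n.+1 -> wspace C N n :=
  linext (fun w => \sum_(k < n.+1 | tnth w k == a) wvec (delete_at k w)).

Definition Theta n (p q : 'I_N) : wspace C N n -> wspace C N n :=
  linext (fun w => \sum_(k < n | tnth w k == p) wvec (replace_at k q w)).

(* On M^(0) every partial_a vanishes, hence so does R2R_0. *)
Definition R2R n : wspace C N n -> wspace C N n :=
  match n with
  | 0 => fun _ => 0
  | n'.+1 => fun v => \sum_(a < N) sh a (partial a v)
  end.

Definition is_eigenvector n (f : wspace C N n -> wspace C N n) (eps : C)
    (v : wspace C N n) : Prop :=
  v != 0 /\ f v = eps *: v.

Definition Mspace n (al : seq nat) : {vspace wspace C N n} :=
  <<[seq wvec w | w in
      [pred w : word N n | [forall k : 'I_N, count_mem k w == nth 0%N al k]]]>>%VS.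

(* A tableau is encoded by the inverse of its filling: t x is the cell        *)
(* (row, column) containing the entry x, where 'I_n stands for {1, ..., n}.   *)
Definition tableau n : finType := {ffun 'I_n -> 'I_N * 'I_n}.

Definition has_shape n (la : seq nat) (t : tableau n) : bool :=
  injectiveb t && [forall c, (c \in codom t) == (c.2 < nth 0%N la c.1)%N].

Definition standard n (t : tableau n) : bool :=
  [forall x, forall y,
     (((t x).1 == (t y).1) && ((t x).2 < (t y).2)%N ==> (x < y)%N) &&
     (((t x).2 == (t y).2) && ((t x).1 < (t y).1)%N ==> (x < y)%N)].

Definition tword n (t : tableau n) : word N n := [tuple (t k).1 | k < n].

(* Replacing each entry x by s x puts y in the cell that held s^-1 y. *)
Definition tperm_act n (s : 'S_n) (t : tableau n) : tableau n :=
  [ffun y => t ((s^-1)%g y)].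

Definition column n (t : tableau n) (c : 'I_n) : {set 'I_n} :=
  [set x | (t x).2 == c].

Definition col_stab n (t : tableau n) : {set 'S_n} :=
  [set s : 'S_n | [forall c, s @: column t c == column t c]].

Definition specht_vec n (t : tableau n) : wspace C N n :=
  \sum_(s in col_stab t) (-1) ^+ s *: wvec (tword (tperm_act s t)).

Definition specht n (la : seq nat) : {vspace wspace C N n} :=
  <<[seq specht_vec t | t in
      [pred t : tableau n | has_shape la t && standard t]]>>%VS.

Definition pairing n (U : {vspace wspace C N n}) (v : wspace C N n) :
    'rV[C]_(\dim U) :=
  \row_j wdot v (vbasis U)`_j.

Fact pairing_is_linear n (U : {vspace wspace C N n}) : linear (pairing U).
Proof.
move=> a u v; apply/rowP => j.
rewrite !mxE /wdot mulr_sumr -big_split /=.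
by apply: eq_bigr => w _; rewrite !ffunE mulrDl mulrA.
Qed.

HB.instance Definition _ n (U : {vspace wspace C N n}) :=
  GRing.isLinear.Build C (wspace C N n) 'rV[C]_(\dim U) *:%R (pairing U)
    (pairing_is_linear U).

(* The orthogonal complement of U in W; see mem_orth_inP. *)
Definition orth_in n (W U : {vspace wspace C N n}) : {vspace wspace C N n} :=
  (W :&: lker (linfun (pairing U)))%VS.

(* The orthogonal projection of W onto U; see orth_projP. *)
Definition orth_proj n (W U : {vspace wspace C N n}) : 'End(wspace C N n) :=
  daddv_pi U (orth_in W U).

(* Meaningful on S^la, which sh i maps into M^(la + e_i). *)
Definition Lmap n (la : seq nat) (i : 'I_N) (v : wspace C N n) :
    wspace C N n.+1 :=
  let mu := incr_nth la i in
  orth_proj (Mspace n.+1 mu) (specht n.+1 mu) (sh i v).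

Fixpoint Theta_chain n (p : 'I_N) (s : seq 'I_N) (v : wspace C N n) :
    wspace C N n :=
  if s is q :: s' then Theta_chain q s' (Theta p q v) else v.

(* For c = b_1, ..., b_(t+1):                                                 *)
(*   Theta_(b_t, b_(t+1)) o ... o Theta_(b_1, b_2) o sh_(b_1).                *)
Definition sh_chain n (c : seq 'I_N) (v : wspace C N n) : wspace C N n.+1 :=
  if c is b :: s then Theta_chain b s (sh b v) else 0.

(* la_k - k, k being counted from 1. *)
Definition shifted_part (la : seq nat) (k : 'I_N) : C :=
  (nth 0%N la k)%:R - k.+1%:R.

(* A strictly increasing sequence b_1 < ... < b_t < i in 'I_N has t < N. *)
Definition chain_sum n (la : seq nat) (i : 'I_N) (v : wspace C N n) :
    wspace C N n.+1 :=
  \sum_(t < N)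
    \sum_(b : t.-tuple 'I_N | sorted (fun x y : 'I_N => x < y)%N (rcons b i))
      (\prod_(j < t)
         (shifted_part la i - shifted_part la (tnth b j))^-1)
        *: sh_chain (rcons b i) v.

Lemma wdot_sumr n k (u : wspace C N n) (a : 'I_k -> C)
    (e : 'I_k -> wspace C N n) :
  wdot u (\sum_j a j *: e j) = \sum_j (a j)^* * wdot u (e j).
Proof.
rewrite /wdot; under [RHS]eq_bigr do rewrite mulr_sumr.
rewrite exchange_big /=; apply: eq_bigr => w _.
rewrite sum_ffunE rmorph_sum mulr_sumr; apply: eq_bigr => j _.
by rewrite !ffunE rmorphM mulrCA.
Qed.

Lemma wdot_eq0 n (u : wspace C N n) : (wdot u u == 0) = (u == 0).
Proof.
apply/eqP/eqP => [uu0|->]; last first.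
  by rewrite /wdot big1 // => w _; rewrite ffunE mul0r.
apply/ffunP => w; rewrite ffunE; apply/eqP.
have := psumr_eq0P (fun w _ => mul_conjC_ge0 (u w)) uu0.
by move=> /(_ w isT) /eqP; rewrite mul_conjC_eq0.
Qed.

Lemma mem_orth_inP n (W U : {vspace wspace C N n}) (v : wspace C N n) :
  reflect (v \in W /\ {in U, forall u, wdot v u = 0}) (v \in orth_in W U).
Proof.
rewrite /orth_in memv_cap memv_ker lfunE /=.
apply: (iffP andP) => -[vW vU]; split=> //.
  move=> u uU; rewrite (coord_vbasis uU) wdot_sumr big1 // => j _.
  by move/eqP/rowP: vU => /(_ j); rewrite !mxE => ->; rewrite mulr0.
apply/eqP/rowP => j; rewrite !mxE vU // vbasis_mem // mem_nth //.
by rewrite size_tuple.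
Qed.

Lemma orth_projP n (W U : {vspace wspace C N n}) (v : wspace C N n) :
  (U <= W)%VS -> v \in W ->
  orth_proj W U v \in U /\
  {in U, forall u, wdot (v - orth_proj W U v) u = 0}.
Proof.
move=> sUW vW; split; first exact: memv_pi.
have dx : (U :&: orth_in W U = 0)%VS.
  apply/eqP; rewrite -subv0; apply/subvP => u; rewrite memv_cap memv0.
  by case/andP => uU /mem_orth_inP[_ /(_ u uU)/eqP]; rewrite wdot_eq0.
have sW : (W <= U + orth_in W U)%VS.
  have sUoW : (U + orth_in W U <= W)%VS by rewrite subv_add sUW capvSl.
  suff /eqP-> : (U + orth_in W U == W)%VS by [].
  rewrite eqEdim sUoW /= dimv_disjoint_sum //.
  rewrite -(limg_ker_dim (linfun (pairing U)) W) addnC leq_add2r.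
  rewrite (leq_trans (dimvS (subvf _))) // dimvf /=.
  by rewrite /dim /= mul1n.
move/subvP/(_ v vW)/(daddv_pi_add dx): sW => defv u uU.
rewrite -{1}defv addrAC subrr add0r.
by have /mem_orth_inP[_ ->] := memv_pi (orth_in W U) U v.
Qed.

End Words.

(* Main.v *)
From HB Require Import structures.
Require Import Defs.
From mathcomp Require Import all_boot all_order all_fingroup all_algebra.
From mathcomp Require Import reals complex.
From mathcomp Require Import zify ring.

(* Theta_(p, q) is the action of the matrix unit e_(q, p) of gl_N on words, and *)
(* S^la is exactly the space of highest weight vectors of weight la: those     *)
(* killed by every Theta_(q, p) with p < q.  One inclusion is the usual        *)
(* cancellation in the column antisymmetrizer.  For the other, the greatest    *)
(* word of a highest weight vector is a lattice word by sl_2-positivity on     *)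
(* initial segments, hence comes from a standard tableau t, and a multiple of  *)
(* w_t can be subtracted.                                                      *)
(*   The chain sums Z_m ending in m satisfy                                    *)
(*     Z_m = sh_m v + sum_(b < m) (x - c_b)^-1 Theta_(b, m) Z_b                *)
(* with c_b = la_b - b, and the commutation relations give                     *)
(*     Theta_(q, p) Z_m = [q = m] (x - c_m) / (x - c_p) Z_p   (p < q),         *)
(* so that Z_i is a highest weight vector for x = c_i.  Since sh_i v - Z_i is  *)
(* a sum of images of Theta_(b, i) with b < i, whose adjoints kill highest     *)
(* weight vectors, Z_i is the projection of sh_i v, which is (b).              *)
(*   R2R commutes with all Theta_(p, q), and                                   *)
(*     R2R (sh_a v) = sh_a (R2R v) + sum_b sh_b (Theta_(b, a) v) + (n+1) sh_a v.*)
(* Hence R2R Z_i - c Z_i, with c the claimed eigenvalue, is both a highest     *)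
(* weight vector and a sum of images of Theta_(b, i) with b < i, so it is 0.   *)

Set Implicit Arguments.
Unset Strict Implicit.
Unset Printing Implicit Defensive.

Import Order.TTheory GRing.Theory Num.Theory.
Local Open Scope ring_scope.

(** Both claims rest on one principle. [Theta b i] is adjoint to [Theta i b], and for b < i the
    latter kills highest weight vectors. So a sum of images of such [Theta b i] is orthogonal to
    every highest weight vector ([lowering_orthogonal]), and a vector of both kinds is orthogonal to
    itself, hence 0 by positivity of [wdot]. To use this, [specht_highest_weight] and
    [highest_weight_specht] trade the spanning set of a Specht module for linear equations, against
    which the chain sum can be tested. [Theta_lift_vec] makes the test: the only possible
    obstruction has a factor that vanishes for x = la_i - i, which is why these denominators occur.
    [Lmap_lift] then identifies the chain sum with the projection, and [R2R_lift] computes its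
    eigenvalue from [R2R_Theta] and [R2R_sh]. *)

Lemma nth_leq_sumn (s : seq nat) k : (nth 0 s k <= sumn s)%N.
Proof.
by elim: s k => [|x s IH] [|k] //=; rewrite ?leq_addr // (leq_trans (IH k)) ?leq_addl.
Qed.

Lemma partition_leq_nth n la p q : is_partition n la -> (p <= q)%N ->
  (nth 0 la q <= nth 0 la p)%N.
Proof.
case/and3P=> la_sorted _ _ pq.
case: (ltnP q (size la)) => [q_lt|/(nth_default 0%N)-> //].
have geq_trans : transitive geq by move=> x y z /= yx zy; apply: leq_trans yx.
have geq_refl : reflexive geq by move=> x /=.
apply: (sorted_leq_nth geq_trans geq_refl _ la_sorted);
  by rewrite ?inE ?(leq_ltn_trans pq).
Qed.

Lemma partition_nth_leq n la k : is_partition n la -> (nth 0 la k <= n)%N.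
Proof. by case/and3P=> _ _ /eqP <-; apply: nth_leq_sumn. Qed.

Lemma card_ord_lt n m : (m <= n)%N -> #|[set c : 'I_n | (c < m)%N]| = m.
Proof.
move=> mn; rewrite cardsE -sum1_card.
by rewrite -(big_ord_widen n (fun=> 1%N) mn) sum1_card card_ord.
Qed.

(** * Operators on words and their coefficient formulas *)

Section Words.

Variables (C : numClosedFieldType) (N : nat).
Local Notation W := (wspace C N).

Lemma tnth_insert n (j : 'I_n.+1) (a : 'I_N) (w : word N n) :
  tnth (insert_at j a w) j = a.
Proof. by rewrite tnth_mktuple unlift_none. Qed.

Lemma tnth_insert_lift n (j : 'I_n.+1) (a : 'I_N) (w : word N n) k :
  tnth (insert_at j a w) (lift j k) = tnth w k.
Proof. by rewrite tnth_mktuple liftK. Qed.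

Lemma tnth_delete n (j : 'I_n.+1) (w : word N n.+1) k :
  tnth (delete_at j w) k = tnth w (lift j k).
Proof. by rewrite tnth_mktuple. Qed.

Lemma tnth_replace n (j : 'I_n) (a : 'I_N) (w : word N n) k :
  tnth (replace_at j a w) k = if k == j then a else tnth w k.
Proof. by rewrite tnth_mktuple. Qed.

Lemma delete_insert n (j : 'I_n.+1) (a : 'I_N) (w : word N n) :
  delete_at j (insert_at j a w) = w.
Proof. by apply: eq_from_tnth => k; rewrite tnth_delete tnth_insert_lift. Qed.

Lemma insert_delete n (j : 'I_n.+1) (w : word N n.+1) :
  insert_at j (tnth w j) (delete_at j w) = w.
Proof.
apply: eq_from_tnth => k; case: (unliftP j k) => [k' ->|->].
  by rewrite tnth_insert_lift tnth_delete.
by rewrite tnth_insert.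
Qed.

(* Like v w, but typed in C rather than in the C^o of the definition of wspace, *)
(* so that sums of coefficients live in the ring C.                            *)
Definition wcoef n (v : W n) (w : word N n) : C := v w.

Lemma wcoefP n (u v : W n) : (forall w, wcoef u w = wcoef v w) -> u = v.
Proof. by move=> uv; apply/ffunP. Qed.

Lemma wcoefD n (u v : W n) x : wcoef (u + v) x = wcoef u x + wcoef v x.
Proof. by rewrite /wcoef ffunE. Qed.

Lemma wcoefZ n a (v : W n) x : wcoef (a *: v) x = a * wcoef v x.
Proof. by rewrite /wcoef ffunE. Qed.

Lemma wcoef_sum n (I : Type) (r : seq I) (P : pred I) (F : I -> W n) x :
  wcoef (\sum_(i <- r | P i) F i) x = \sum_(i <- r | P i) wcoef (F i) x.
Proof. by rewrite /wcoef sum_ffunE. Qed.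

Lemma wcoef0 n x : wcoef (0 : W n) x = 0.
Proof. by rewrite /wcoef ffunE. Qed.

Lemma wcoef_wvec n x w : wcoef (wvec C w : W n) x = (x == w)%:R.
Proof. by rewrite /wcoef ffunE. Qed.

Lemma wdotE n (u v : W n) : wdot u v = \sum_w wcoef u w * (wcoef v w)^*.
Proof. by []. Qed.

Lemma linextE m n (f : word N m -> W n) v x :
  wcoef (linext f v) x = \sum_w wcoef v w * wcoef (f w) x.
Proof. by rewrite wcoef_sum; apply: eq_bigr => w _; rewrite wcoefZ. Qed.

Fact linext_is_linear m n (f : word N m -> W n) : linear (linext f).
Proof.
move=> a u v; apply: wcoefP => x; rewrite wcoefD wcoefZ !linextE mulr_sumr -big_split.
by apply: eq_bigr => w _; rewrite wcoefD wcoefZ mulrDl mulrA.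
Qed.

HB.instance Definition _ n p q :=
  GRing.isLinear.Build C (W n) (W n) *:%R (@Theta C N n p q)
    (linext_is_linear _).
HB.instance Definition _ n a :=
  GRing.isLinear.Build C (W n) (W n.+1) *:%R (@sh C N n a)
    (linext_is_linear _).
HB.instance Definition _ n a :=
  GRing.isLinear.Build C (W n.+1) (W n) *:%R (@partial C N n a)
    (linext_is_linear _).

(** The operators are defined by pushing words forward. Inverting each elementary move ([g] undoes
    [f]) gives the coefficient at [x] by pulling [x] back, and all later identities compare such
    coefficients. *)
Lemma linext_words m n (I : finType) (P : word N m -> pred I)
    (f : word N m -> I -> word N n) (Q : pred I) (g : I -> word N m) v x :
  (forall w k, P w k && (x == f w k) = Q k && (w == g k)) ->
  wcoef (linext (fun w => \sum_(k | P w k) wvec C (f w k)) v) x =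
  \sum_(k | Q k) wcoef v (g k).
Proof.
move=> PQ; rewrite linextE.
transitivity (\sum_w \sum_k if P w k && (x == f w k) then wcoef v w else 0).
  apply: eq_bigr => w _; rewrite wcoef_sum mulr_sumr big_mkcond /=.
  apply: eq_bigr => k _; rewrite wcoef_wvec.
  by case: ifP => //= _; case: eqP; rewrite ?mulr1 ?mulr0.
rewrite exchange_big [RHS]big_mkcond; apply: eq_bigr => k _.
rewrite -big_mkcond (eq_bigl (fun w => Q k && (w == g k))) //.
by case: (Q k); rewrite ?big_pred0_eq ?big_pred1_eq.
Qed.

Lemma ThetaE n p q (v : W n) x :
  wcoef (Theta p q v) x = \sum_(k < n | tnth x k == q) wcoef v (replace_at k p x).
Proof.
apply: linext_words => w k; apply/andP/andP => -[/eqP<- /eqP->]; split.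
- by rewrite tnth_replace eqxx.
- apply/eqP/eq_from_tnth => l; rewrite !tnth_replace.
  by case: eqP => [->|].
- by rewrite tnth_replace eqxx.
- apply/eqP/eq_from_tnth => l; rewrite !tnth_replace.
  by case: eqP => [->|].
Qed.

Lemma shE n a (v : W n) x :
  wcoef (sh a v) x = \sum_(j < n.+1 | tnth x j == a) wcoef v (delete_at j x).
Proof.
rewrite (linext_words (P := fun _ _ => true)
  (Q := fun j => tnth x j == a) (g := fun j => delete_at j x)) // => w k /=.
apply/eqP/andP => [->|[/eqP<- /eqP->]].
  by rewrite tnth_insert delete_insert !eqxx.
by rewrite insert_delete.
Qed.

Lemma partialE n a (v : W n.+1) x :
  wcoef (partial a v) x = \sum_(j < n.+1) wcoef v (insert_at j a x).
Proof.
apply: linext_words => w k /=.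
apply/andP/eqP => [[/eqP<- /eqP->]|->].
  by rewrite insert_delete.
by rewrite tnth_insert delete_insert !eqxx.
Qed.

(** The same matrix unit acting only on the tensor factors in [A]. All of them give [Theta]; initial
    segments serve to prove that leading words are lattice words. *)
Definition ThetaA n (A : {set 'I_n}) p q (v : W n) : W n :=
  [ffun x => \sum_(k in A | tnth x k == q) wcoef v (replace_at k p x)].

Lemma ThetaAE n A p q (v : W n) x : wcoef (ThetaA A p q v) x =
  \sum_(k in A | tnth x k == q) wcoef v (replace_at k p x).
Proof. by rewrite /wcoef ffunE. Qed.

Lemma ThetaAT n p q (v : W n) : ThetaA setT p q v = Theta p q v.
Proof.
by apply: wcoefP => x; rewrite ThetaAE ThetaE; apply: eq_bigl => k; rewrite inE.
Qed.

Lemma replace_replace n (k : 'I_n) a b (x : word N n) :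
  replace_at k a (replace_at k b x) = replace_at k a x.
Proof.
by apply: eq_from_tnth => l; rewrite !tnth_replace; case: eqP.
Qed.

Lemma replaceC n (k l : 'I_n) a b (x : word N n) : k != l ->
  replace_at k a (replace_at l b x) = replace_at l b (replace_at k a x).
Proof.
move=> kl; apply: eq_from_tnth => m; rewrite !tnth_replace.
by case: eqP => // ->; rewrite (negPf kl).
Qed.

(* [e_(q, p), e_(s, r)] = [p = s] e_(q, r) - [q = r] e_(s, p), for the matrix  *)
(* unit e_(q, p) acting as Theta_(p, q).                                       *)
Lemma ThetaA_comm n (A : {set 'I_n}) p q r s (v : W n) :
  ThetaA A p q (ThetaA A r s v) + (q == r)%:R *: ThetaA A p s v =
  ThetaA A r s (ThetaA A p q v) + (p == s)%:R *: ThetaA A r q v.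
Proof.
(* The double replacements at two distinct positions. They commute, so only replacing the same
   position twice contributes to the commutator. *)
pose T p q r s (x : word N n) : C := \sum_(k in A | tnth x k == q)
  \sum_(l in A | (l != k) && (tnth x l == s))
     wcoef v (replace_at l r (replace_at k p x)).
have ThTh p' q' r' s' x : wcoef (ThetaA A p' q' (ThetaA A r' s' v)) x =
  (p' == s')%:R * wcoef (ThetaA A r' q' v) x + T p' q' r' s' x.
  rewrite !ThetaAE mulr_sumr -big_split /=; apply: eq_bigr => k /andP[kA _].
  rewrite ThetaAE (bigID (pred1 k)) /=; congr (_ + _).
    rewrite (eq_bigl (fun l => (p' == s') && (l == k))); last first.
      move=> l /=; case: (eqVneq l k) => [->|]; last by rewrite !andbF.
      by rewrite kA tnth_replace eqxx andbT.
    case: eqP => _; last by rewrite big_pred0_eq mul0r.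
    by rewrite big_pred1_eq mul1r replace_replace.
  apply: eq_bigl => l; rewrite -andbA tnth_replace andbC -!andbA.
  by case: (eqVneq l k) => //=; rewrite ?andbF ?andbT // andbC.
apply: wcoefP => x; rewrite !wcoefD !wcoefZ !ThTh.
have -> : T p q r s x = T r s p q x.
  rewrite /T (exchange_big_dep (fun l => (l \in A) && (tnth x l == s))) /=.
    apply: eq_bigr => l /andP[lA xl]; apply: eq_big => [k|k].
      by rewrite lA xl (eq_sym k) !andbT -andbA (andbC (l != k)).
    by case/andP=> _ /and3P[_ lk _]; rewrite replaceC.
  by move=> k l _ /and3P[-> _].
rewrite [q == r]eq_sym; ring.
Qed.

Lemma Theta_comm n p q r s (v : W n) :
  Theta p q (Theta r s v) + (q == r)%:R *: Theta p s v =
  Theta r s (Theta p q v) + (p == s)%:R *: Theta r q v.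
Proof. by rewrite -!ThetaAT ThetaA_comm. Qed.

Lemma ThetaA_adj n (A : {set 'I_n}) p q (u v : W n) :
  wdot (ThetaA A p q u) v = wdot u (ThetaA A q p v).
Proof.
rewrite !wdotE.
transitivity (\sum_x \sum_(k in A | tnth x k == q)
   wcoef u (replace_at k p x) * (wcoef v x)^*).
  by apply: eq_bigr => x _; rewrite ThetaAE mulr_suml.
transitivity (\sum_x \sum_(k in A | tnth x k == p)
   wcoef u x * (wcoef v (replace_at k q x))^*); last first.
  by apply: eq_bigr => x _; rewrite ThetaAE rmorph_sum mulr_sumr.
rewrite (exchange_big_dep (fun k => k \in A)) /=; last by move=> ? ? _ /andP[].
rewrite [RHS](exchange_big_dep (fun k => k \in A)) /=; last by move=> ? ? _ /andP[].
apply: eq_bigr => k kA.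
rewrite (reindex_onto (replace_at k q) (replace_at k p)) /=; last first.
  move=> x /andP[_ /eqP <-]; apply: eq_from_tnth => l; rewrite !tnth_replace.
  by case: eqP => // ->.
have H x : replace_at k p (replace_at k q x) = x <-> tnth x k = p.
  split=> [<-|xp]; first by rewrite tnth_replace eqxx.
  apply: eq_from_tnth => l; rewrite !tnth_replace.
  by case: eqP => // ->.
apply: eq_big => x; first by rewrite kA tnth_replace !eqxx /=; apply/eqP/eqP; apply H.
by case/andP=> _ /eqP ->.
Qed.

Lemma Theta_adj n p q (u v : W n) :
  wdot (Theta p q u) v = wdot u (Theta q p v).
Proof. by rewrite -!ThetaAT ThetaA_adj. Qed.

(** * Commutation of [Theta], [sh], [partial] and [R2R] *)

Lemma big_lift n (j : 'I_n.+1) (P : pred 'I_n.+1) (F : 'I_n.+1 -> C) :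
  \sum_(k | P k) F k =
  (if P j then F j else 0) + \sum_(k | P (lift j k)) F (lift j k).
Proof.
by rewrite big_mkcond (bigD1_ord j) //= [in RHS]big_mkcond.
Qed.

(** The extra term arises when the replaced letter is the inserted one. *)
Lemma Theta_sh n p q a (v : W n) :
  Theta p q (sh a v) = sh a (Theta p q v) + (p == a)%:R *: sh q v.
Proof.
apply: wcoefP => x; rewrite wcoefD wcoefZ ThetaE.
transitivity (\sum_j \sum_(k | (tnth x k == q) && (tnth (replace_at k p x) j == a))
    wcoef v (delete_at j (replace_at k p x))).
  under eq_bigr do rewrite shE.
  by rewrite (exchange_big_dep xpredT).
have -> : (p == a)%:R * wcoef (sh q v) x = \sum_j if (tnth x j == q) && (p == a) then
   wcoef v (delete_at j x) else 0.
  rewrite -big_mkcond shE.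
  case: (p == a); last by rewrite mul0r big1 // => j; rewrite andbF.
  by rewrite mul1r; apply: eq_bigl => j; rewrite andbT.
rewrite shE [X in _ = X + _]big_mkcond /= -big_split /=; apply: eq_bigr => j _.
rewrite (big_lift j) tnth_replace eqxx addrC; congr (_ + _).
  case: ifP => // _; congr (wcoef v _); apply: eq_from_tnth => l.
  by rewrite !tnth_delete tnth_replace eq_sym (negPf (neq_lift _ _)).
case: ifP => xj; last first.
  rewrite big_pred0 // => k.
  by rewrite tnth_replace (negPf (neq_lift _ _)) xj andbF.
rewrite ThetaE; apply: eq_big => k.
  by rewrite tnth_replace (negPf (neq_lift _ _)) xj andbT tnth_delete.
move=> _; congr (wcoef v _); apply: eq_from_tnth => l.
by rewrite !(tnth_delete, tnth_replace) (inj_eq lift_inj).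
Qed.

Lemma partial_Theta n p q a (v : W n.+1) :
  partial a (Theta p q v) = Theta p q (partial a v) + (a == q)%:R *: partial p v.
Proof.
apply: wcoefP => x; rewrite wcoefD wcoefZ partialE ThetaE.
transitivity (\sum_j (\sum_(k | tnth x k == q) wcoef v (insert_at j a (replace_at k p x))
   + (a == q)%:R * wcoef v (insert_at j p x))).
  apply: eq_bigr => j _; rewrite ThetaE (big_lift j) tnth_insert addrC.
  congr (_ + _).
    apply: eq_big => k; first by rewrite tnth_insert_lift.
    move=> _; congr (wcoef v _); apply: eq_from_tnth => l; rewrite tnth_replace.
    case: (unliftP j l) => [m ->|->]; last first.
      by rewrite (negPf (neq_lift _ _)) !tnth_insert.
    by rewrite !tnth_insert_lift tnth_replace (inj_eq lift_inj).
  case: eqP => _; rewrite ?mul0r ?mul1r //.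
  congr (wcoef v _); apply: eq_from_tnth => l; rewrite tnth_replace.
  case: (unliftP j l) => [m ->|->]; last by rewrite eqxx tnth_insert.
  by rewrite eq_sym (negPf (neq_lift _ _)) !tnth_insert_lift.
rewrite big_split exchange_big -mulr_sumr partialE /=; congr (_ + _).
by apply: eq_bigr => k _; rewrite partialE.
Qed.

Lemma sh_sh n a b (v : W n) : sh b (sh a v) = sh a (sh b v).
Proof.
(* The coefficient of [v] at [x] with positions [j] and [l] deleted, with junk value 0 for [j = l].
   It is symmetric in the two positions. *)
pose D (x : word N n.+2) (j l : 'I_n.+2) : C :=
  if unlift j l is Some k then wcoef v (delete_at k (delete_at j x)) else 0.
have shD c d x : wcoef (sh d (sh c v)) x =
  \sum_(j | tnth x j == d) \sum_(l | (tnth x l == c) && (l != j)) D x j l.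
  rewrite shE; apply: eq_bigr => j _; rewrite (big_lift j) eqxx andbF add0r shE.
  apply: eq_big => k; first by rewrite tnth_delete (eq_sym _ j) neq_lift andbT.
  by move=> _; rewrite /D liftK.
have DC x j l : l != j -> D x j l = D x l j.
  rewrite eq_sym => jl; rewrite /D.
  have [k lE ->] := unlift_some jl.
  rewrite eq_sym in jl; have [k' jE ->] := unlift_some jl.
  congr (wcoef v _); apply: eq_from_tnth => m; rewrite !tnth_delete; congr (tnth x _).
  apply/val_inj => /=; move: (congr1 val lE) (congr1 val jE).
  by rewrite /= /bump; lia.
apply: wcoefP => x; rewrite !shD.
rewrite (exchange_big_dep (fun l => tnth x l == a)) /=; last by move=> ? ? _ /andP[].
apply: eq_bigr => l xl; apply: eq_big => j; first by rewrite xl (eq_sym l).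
by case/and3P=> _ _ /DC.
Qed.

Lemma partial_sh n a b (v : W n) : partial b (sh a v) =
  (if n is n'.+1 return W n -> W n then fun v => sh a (partial b v)
   else fun=> 0) v + Theta b a v + (a == b)%:R *: (n.+1%:R *: v).
Proof.
apply: wcoefP => x; rewrite !wcoefD !wcoefZ partialE.
transitivity (\sum_(j < n.+1) \sum_(k | tnth x k == a)
    wcoef v (delete_at (lift j k) (insert_at j b x)) +
  (a == b)%:R * (n.+1%:R * wcoef v x)).
  have -> : (a == b)%:R * (n.+1%:R * wcoef v x) =
      \sum_(j < n.+1) (a == b)%:R * wcoef v x.
    by rewrite sumr_const card_ord -mulrnAr (mulr_natl (wcoef v x)).
  rewrite -big_split /=.
  apply: eq_bigr => j _; rewrite shE (big_lift j) addrC; congr (_ + _); last first.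
    by apply: eq_bigl => k; rewrite tnth_insert_lift.
  rewrite tnth_insert delete_insert eq_sym.
  by case: ifP; rewrite ?mul0r ?mul1r.
congr (_ + _); rewrite exchange_big ThetaE; case: n v x => [|n] v x.
  by rewrite !big_pred0 ?wcoef0 ?addr0 // => -[].
rewrite shE -big_split; apply: eq_bigr => k _.
(* In the word with n + 1 letters, [b] has n + 2 slots, but the two slots beside the deleted
   position [k] yield the same word. Splitting off the slot before [k] leaves the n + 1 slots of
   [sh a (partial b v)]; the spare one puts [b] in place of [k], which is the [Theta] term. *)
rewrite partialE (big_lift (widen_ord (leqnSn _) k)) /= addrC; congr (_ + _); last first.
  apply: eq_bigr => j _; congr (wcoef v _); apply: eq_from_tnth => m.
  set j1 := lift (widen_ord (leqnSn n.+1) k) j; rewrite tnth_delete.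
  have j1E : j1 = bump k j :> nat by [].
  clearbody j1.
  case: (unliftP j m) => [l ->|->].
    have -> : lift (lift j1 k) (lift j l) = lift j1 (lift k l).
      by apply: val_inj; rewrite /= j1E /bump; lia.
    by rewrite !tnth_insert_lift tnth_delete.
  have -> : lift (lift j1 k) j = j1.
    by apply: val_inj; rewrite /= j1E /bump; lia.
  by rewrite !tnth_insert.
congr (wcoef v _); apply: eq_from_tnth => m; rewrite tnth_delete tnth_replace.
set j1 := widen_ord (leqnSn n.+1) k; have j1E : j1 = k :> nat by [].
clearbody j1.
case: eqP => [->|/eqP mk].
  have -> : lift (lift j1 k) k = j1.
    by apply: val_inj; rewrite /= j1E /bump; lia.
  by rewrite tnth_insert.
have -> : lift (lift j1 k) m = lift j1 m.
  by apply: val_inj; move: mk; rewrite -val_eqE /= j1E /bump; lia.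
by rewrite tnth_insert_lift.
Qed.

Lemma R2R_Theta n p q (v : W n) : R2R (Theta p q v) = Theta p q (R2R v).
Proof.
case: n v => [|n] v /=; first by rewrite linear0.
rewrite linear_sum; have TT a : Theta p q (sh a (partial a v)) =
    sh a (partial a (Theta p q v)) + ((p == a)%:R *: sh q (partial a v)
    - (a == q)%:R *: sh a (partial p v)).
  rewrite Theta_sh partial_Theta linearD linearZ /=.
  by rewrite -[in RHS]addrA [_ *: _ + (_ - _)]addrC subrK.
rewrite (eq_bigr _ (fun a _ => TT a)) big_split sumrB /=.
(* Summed over [a], both corrections become [sh q (partial p v)] and cancel. *)
apply/esym/eqP; rewrite -subr_eq0 addrAC subrr add0r; apply/eqP.
rewrite (bigD1 p) // [X in _ - X](bigD1 q) //= !eqxx !big1 ?addr0 ?subrr // => a.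
  by move=> /negPf ->; rewrite scale0r.
by rewrite eq_sym => /negPf ->; rewrite scale0r.
Qed.

Lemma R2R_sh n a (v : W n) : R2R (sh a v) =
  sh a (R2R v) + \sum_b sh b (Theta b a v) + n.+1%:R *: sh a v.
Proof.
rewrite /=; under eq_bigr do rewrite partial_sh !linearD !linearZ /=.
rewrite !big_split /=; congr (_ + _ + _).
  case: n v => [|n] v /=; first by rewrite !linear0 big1 // => b _; rewrite linear0.
  by rewrite linear_sum; apply: eq_bigr => b _; rewrite sh_sh.
rewrite (bigD1 a) //= eqxx scale1r big1 ?addr0 // => b.
by rewrite eq_sym => /negPf ->; rewrite scale0r.
Qed.

(** * Highest weight vectors and Specht modules *)

Lemma span_linear_eq (U V : vectType C) (f g : {linear U -> V}) (X : seq U) v :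
  {in X, f =1 g} -> v \in <<X>>%VS -> f v = g v.
Proof.
move=> fg vX; rewrite (coord_span (X := in_tuple X) vX) !linear_sum.
by apply: eq_bigr => i _; rewrite !linearZ /= fg // mem_nth.
Qed.

Lemma linext_wvec m n (f : word N m -> W n) w : linext f (wvec C w) = f w.
Proof.
apply: wcoefP => x; rewrite linextE (bigD1 w) //= wcoef_wvec eqxx mul1r.
by rewrite big1 ?addr0 // => y /negPf wy; rewrite wcoef_wvec wy mul0r.
Qed.

Definition letter_count n (A : {set 'I_n}) (a : 'I_N) (x : word N n) :=
  #|[set k in A | tnth x k == a]|.

Lemma ThetaA_diag n (A : {set 'I_n}) a (v : W n) x :
  wcoef (ThetaA A a a v) x = (letter_count A a x)%:R * wcoef v x.
Proof.
rewrite ThetaAE (eq_bigr (fun=> wcoef v x)).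
  by rewrite sumr_const mulr_natl /letter_count cardsE.
move=> k /andP[_ /eqP xk]; congr wcoef; apply: eq_from_tnth => l.
by rewrite tnth_replace; case: eqP => // ->.
Qed.

Lemma count_mem_letter_count n a (x : word N n) :
  count_mem a x = letter_count setT a x.
Proof.
rewrite /letter_count -sum1_count big_tuple sum1dep_card.
by apply: eq_card => k; rewrite !inE.
Qed.

(** [Theta a a] multiplies a word by its number of letters [a], so this describes the space of
    evaluation [mu] by operators; see [memMP]. *)
Definition weight n (mu : seq nat) (v : W n) : Prop :=
  forall a : 'I_N, Theta a a v = (nth 0%N mu a)%:R *: v.

Lemma weight_letter_count n mu (v : W n) x a :
  weight mu v -> wcoef v x != 0 -> letter_count setT a x = nth 0%N mu a.
Proof.
move=> /(_ a) /(congr1 (fun u => wcoef u x)).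
rewrite -ThetaAT ThetaA_diag wcoefZ => + vx => /(mulIf vx)/eqP.
by rewrite eqr_nat => /eqP.
Qed.

Lemma weight_wvec n mu (w : word N n) :
  (forall a, letter_count setT a w = nth 0%N mu a) -> weight mu (wvec C w).
Proof.
move=> cw a; apply: wcoefP => x; rewrite -ThetaAT ThetaA_diag wcoefZ wcoef_wvec.
by case: eqP => [->|_]; rewrite ?mulr0 // cw.
Qed.

Lemma weight_linear n mu (I : Type) (r : seq I) (P : pred I) c (F : I -> W n) :
  (forall i, P i -> weight mu (F i)) -> weight mu (\sum_(i <- r | P i) c i *: F i).
Proof.
move=> FP a; rewrite linear_sum scaler_sumr; apply: eq_bigr => i Pi.
by rewrite linearZ /= FP // !scalerA mulrC.
Qed.

Lemma wcoef_sum_wvec n (v : W n) : v = \sum_w wcoef v w *: wvec C w.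
Proof.
apply: wcoefP => x; rewrite wcoef_sum (bigD1 x) //= wcoefZ wcoef_wvec eqxx mulr1.
rewrite big1 ?addr0 // => w /negPf xw.
by rewrite wcoefZ wcoef_wvec eq_sym xw mulr0.
Qed.

Lemma memMP n mu (v : W n) : v \in Mspace C N n mu <-> weight mu v.
Proof.
split=> [vM a|vmu].
  move: vM; apply: (span_linear_eq (f := Theta a a) (g := *:%R _)).
  move=> _ /mapP[w + ->]; rewrite mem_enum inE => /forallP cw.
  apply: weight_wvec => b.
  by rewrite -count_mem_letter_count; apply/eqP.
rewrite (wcoef_sum_wvec v) rpred_sum // => w _.
have [->|vw] := eqVneq (wcoef v w) 0; first by rewrite scale0r mem0v.
apply/memvZ/memv_span/mapP; exists w => //; rewrite mem_enum inE.
by apply/forallP => a; rewrite count_mem_letter_count (weight_letter_count a vmu vw).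
Qed.

Definition highest_weight n (mu : seq nat) (v : W n) : Prop :=
  weight mu v /\ forall p q : 'I_N, (p < q)%N -> Theta q p v = 0.

Lemma col_stabP n (t : tableau N n) (s : 'S_n) :
  reflect (forall x, (t (s x)).2 = (t x).2) (s \in col_stab t).
Proof.
rewrite inE; apply: (iffP forallP) => [H x|H c].
  have /eqP/setP/(_ (s x)) := H (t x).2.
  rewrite mem_imset; last exact: perm_inj.
  by rewrite !inE eqxx => /esym/eqP.
rewrite eqEcard card_imset ?leqnn ?andbT; last exact: perm_inj.
by apply/subsetP => _ /imsetP[x + ->]; rewrite !inE H.
Qed.

Lemma tnth_tword_act n (t : tableau N n) (s : 'S_n) k :
  tnth (tword (tperm_act s t)) k = (t ((s^-1)%g k)).1.
Proof. by rewrite tnth_mktuple ffunE. Qed.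

(** * Specht vectors are highest weight vectors *)

Section Shape.

Variables (n : nat) (la : seq nat) (t : tableau N n).
Hypotheses (la_part : is_partition n la) (t_shape : has_shape la t).

Lemma shape_inj : injective t.
Proof. by case/andP: t_shape => /injectiveP. Qed.

Lemma shapeP c : (c \in codom t) = (c.2 < nth 0 la c.1)%N.
Proof. by case/andP: t_shape => _ /forallP/(_ c)/eqP. Qed.

Lemma letter_count_tword (s : 'S_n) a :
  letter_count setT a (tword (tperm_act s t)) = nth 0%N la a.
Proof.
rewrite -[RHS](card_ord_lt (partition_nth_leq a la_part)).
have pair_inj : injective (pair a : 'I_n -> _) by move=> c d [].
rewrite -(card_imset _ pair_inj).
rewrite /letter_count -(card_imset _ (inj_comp shape_inj (@perm_inj _ (s^-1)%g))).
apply: eq_card => -[r c]; apply/imsetP/imsetP => -[k]; rewrite !inE.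
  rewrite tnth_tword_act => /eqP ka /= kE.
  exists (t ((s^-1)%g k)).2; last by rewrite kE -ka; case: (t _).
  by rewrite inE -ka -shapeP codom_f.
move=> ka [-> ->]; have /codomP[x xE] : (a, k) \in codom t by rewrite shapeP.
exists (s x); rewrite ?inE ?tnth_tword_act /= ?permK -?xE //.
Qed.

(* The terms in which the entry x of row q is moved to row p cancel in pairs    *)
(* under the transposition of x and the entry y in row p of the same column.   *)
Lemma Theta_specht_vec (p q : 'I_N) : (p < q)%N -> Theta q p (specht_vec C t) = 0.
Proof.
move=> pq; pose f (x : 'I_n) (s : 'S_n) :=
  replace_at (s x) p (tword (tperm_act s t)).
have -> : Theta q p (specht_vec C t) =
    \sum_(x | (t x).1 == q) \sum_(s in col_stab t) (-1) ^+ s *: wvec C (f x s).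
  rewrite exchange_big linear_sum; apply: eq_bigr => s _.
  rewrite linearZ /= /Theta linext_wvec -scaler_sumr; congr (_ *: _).
  rewrite (reindex_inj (@perm_inj _ s)) /=; apply: eq_bigl => x.
  by rewrite tnth_tword_act permK.
(* Row [p] lies above row [q], so it is at least as long and has an entry [y] in the column of
   [x]. *)
rewrite big1 // => x /eqP xq; have /codomP[y yE] : (p, (t x).2) \in codom t.
  rewrite shapeP /=; apply: leq_trans (partition_leq_nth la_part (ltnW pq)).
  by rewrite -xq -shapeP codom_f.
have xy : x != y by apply: contraTneq pq => xy; rewrite -xq xy -yE ltnn.
have fxy s : f x (tperm x y * s)%g = f x s.
  apply: eq_from_tnth => k; rewrite !tnth_replace !tnth_tword_act.
  rewrite permM tpermL invMg permM tpermV.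
  have [->|ky] := eqVneq k (s y).
    by rewrite (inj_eq perm_inj) eq_sym (negPf xy) permK -yE.
  have [->|kx] := eqVneq k (s x); first by rewrite permK tpermL -yE.
  rewrite tpermD //; apply: contraNneq kx => e.
    by rewrite e permKV.
  by case/negP: ky; rewrite e permKV.
set S := \sum_(s in _) _.
suff : S = - S.
  move/eqP; rewrite -addr_eq0 -mulr2n -scaler_nat scaler_eq0.
  by rewrite pnatr_eq0 => /eqP.
rewrite {1}/S (reindex_inj (mulgI (tperm x y))) /= -sumrN.
apply: eq_big => s.
  have txy z : (t (tperm x y z)).2 = (t z).2.
    by case: tpermP => // ->; rewrite -yE.
  apply/col_stabP/col_stabP => H z.
    by have := H (tperm x y z); rewrite permM tpermK txy.
  by rewrite permM H txy.
by move=> _; rewrite fxy odd_permM odd_tperm xy signr_addb expr1 mulN1r scaleNr.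
Qed.

Lemma highest_weight_specht_vec : highest_weight la (specht_vec C t).
Proof.
split; last exact: Theta_specht_vec.
by apply: weight_linear => s _; apply: weight_wvec => a; apply: letter_count_tword.
Qed.

End Shape.

Lemma specht_highest_weight n la (v : W n) : is_partition n la ->
  v \in specht C N n la -> highest_weight la v.
Proof.
move=> la_part vS.
have S (X : W n) : X \in [seq specht_vec C t | t in
    [pred t : tableau N n | has_shape la t && standard t]] -> highest_weight la X.
  move=> /mapP[t + ->]; rewrite mem_enum inE => /andP[sh_t _].
  exact: highest_weight_specht_vec.
split; last first.
  move=> p q pq; move: vS; apply: (span_linear_eq (f := Theta q p) (g := \0)) => X /S.
  by case=> _ /(_ _ _ pq).
apply/memMP; move: v vS; apply/subvP/span_subvP => X /S[XM _].
exact/memMP.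
Qed.

(* Lexicographic order in which the last letter is the most significant. *)
Definition word_lt n (w x : word N n) : bool :=
  [exists k : 'I_n, (tnth w k < tnth x k)%N &&
     [forall j : 'I_n, (k < j)%N ==> (tnth w j == tnth x j)]].

Lemma word_ltP n (w x : word N n) :
  reflect (exists2 k : 'I_n, (tnth w k < tnth x k)%N &
             forall j : 'I_n, (k < j)%N -> tnth w j = tnth x j)
          (word_lt w x).
Proof.
apply: (iffP existsP) => [[k /andP[wx /forallP H]]|[k wx H]]; exists k => //.
  by move=> j kj; apply/eqP; move/implyP: (H j); apply.
by rewrite wx; apply/forallP => j; apply/implyP => /H ->.
Qed.

Lemma last_difference n (w x : word N n) : w != x ->
  exists2 k : 'I_n, tnth w k != tnth x k &
    forall j : 'I_n, (k < j)%N -> tnth w j = tnth x j.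
Proof.
move=> wx; have /existsP[k0 k0P] : [exists k, tnth w k != tnth x k].
  apply: contraR wx => /existsPn wx; apply/eqP/eq_from_tnth => k.
  by apply/eqP; have := wx k; rewrite negbK.
pose differ k := tnth w k != tnth x k.
case: (@arg_maxnP _ k0 differ (@nat_of_ord n) k0P) => k kP kmax.
exists k => // j kj; apply/eqP; apply: contraTT kj => /kmax.
by rewrite -leqNgt.
Qed.

Lemma word_lt_total n (w x : word N n) : w != x -> word_lt w x || word_lt x w.
Proof.
case/last_difference => k wx H; case: (ltngtP (tnth w k) (tnth x k)) => wxk.
- by apply/orP; left; apply/word_ltP; exists k.
- by apply/orP; right; apply/word_ltP; exists k => // j /H.
- by case/eqP: wx; apply: val_inj.
Qed.

Lemma word_ltxx n (w : word N n) : word_lt w w = false.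
Proof. by apply/word_ltP => -[k]; rewrite ltnn. Qed.

Lemma word_lt_trans n : transitive (@word_lt n).
Proof.
move=> y x z /word_ltP[k xyk xyH] /word_ltP[l yzl yzH]; apply/word_ltP.
have [kl|lk|/val_inj kl] := ltngtP k l.
- by exists l => [|j lj]; [rewrite xyH | rewrite (xyH j (ltn_trans kl lj)) yzH].
- by exists k => [|j kj]; [rewrite -yzH | rewrite -(yzH j (ltn_trans lk kj)) xyH].
- exists k => [|j kj]; first by rewrite (ltn_trans xyk) // kl.
  by rewrite xyH ?yzH // -kl.
Qed.

Definition word_rank n (w : word N n) := #|[set x | word_lt x w]|.

Lemma word_rank_lt n (w x : word N n) : word_lt w x -> (word_rank w < word_rank x)%N.
Proof.
move=> wx; apply/proper_card/properP; split.
  by apply/subsetP => y; rewrite !inE => /word_lt_trans; apply.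
by exists w; rewrite inE ?word_ltxx.
Qed.

(** * Leading words *)

Section StandardTableau.

Variables (n : nat) (la : seq nat) (t : tableau N n).
Hypotheses (t_shape : has_shape la t) (t_std : standard t).

(** At the last difference [k], all greater entries are fixed by the inverse of [s]. If the letter
    grew at [k], the preimage of [k] would lie below [k] in its column, hence be greater by
    standardness, hence be fixed: a contradiction. *)
Lemma tword_act_lt s :
  s \in col_stab t -> tword (tperm_act s t) != tword t ->
  word_lt (tword (tperm_act s t)) (tword t).
Proof.
move=> /col_stabP sC /last_difference[k].
have stC x : (t ((s^-1)%g x)).2 = (t x).2 by rewrite -[in RHS](permKV s x) sC.
rewrite tnth_tword_act tnth_mktuple => tk tj; apply/word_ltP; exists k => //.
rewrite tnth_tword_act tnth_mktuple ltnNge; apply/negP => le_tk.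
have fix_gt (j : 'I_n) : (k < j)%N -> (s^-1)%g j = j.
  move=> /tj; rewrite tnth_tword_act tnth_mktuple => t1.
  apply: (shape_inj t_shape).
  by rewrite [LHS]surjective_pairing t1 stC -surjective_pairing.
have /forallP/(_ k)/forallP/(_ ((s^-1)%g k))/andP[_] := t_std.
rewrite stC eqxx /= ltn_neqAle le_tk val_eqE eq_sym tk /= => /fix_gt/perm_inj sk.
by rewrite sk eqxx in tk.
Qed.

Lemma wcoef_specht_vec x : wcoef (specht_vec C t) x =
  \sum_(s in col_stab t | tword (tperm_act s t) == x) (-1) ^+ s.
Proof.
rewrite wcoef_sum [RHS]big_mkcondr; apply: eq_bigr => s _.
by rewrite wcoefZ wcoef_wvec eq_sym; case: eqP; rewrite ?mulr1 ?mulr0.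
Qed.

Lemma wcoef_specht_vec_lt x : wcoef (specht_vec C t) x != 0 -> x != tword t ->
  word_lt x (tword t).
Proof.
move=> + xt; rewrite wcoef_specht_vec; apply: contraNT => x_nlt.
rewrite big_pred0 // => s; apply/negP => /andP[sC /eqP sx].
by move: (tword_act_lt sC); rewrite sx xt => /(_ isT); apply/negP.
Qed.

Lemma wcoef_specht_vec_tword : wcoef (specht_vec C t) (tword t) = 1.
Proof.
rewrite wcoef_specht_vec (big_pred1 1%g) ?odd_perm1 // => s /=.
apply/andP/eqP => [[/col_stabP sC /eqP st]|->]; last first.
  split; first by apply/col_stabP => x; rewrite perm1.
  by apply/eqP/eq_from_tnth => k; rewrite tnth_tword_act invg1 perm1 tnth_mktuple.
apply/permP => x; rewrite perm1; apply: (shape_inj t_shape).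
have := congr1 (fun w => tnth w (s x)) st.
rewrite tnth_tword_act permK tnth_mktuple => e.
by rewrite [LHS]surjective_pairing -e sC -surjective_pairing.
Qed.

End StandardTableau.

(* With E = Theta_(q, p) and F = Theta_(p, q) on A: as E u = 0, one has         *)
(* 0 <= <F u, F u> = <E F u, u> = <[E, F] u, u> = (a - b) <u, u>.              *)
Lemma raising_kernel_dominant n (A : {set 'I_n}) (p q : 'I_N) (u : W n) a b :
  p != q -> u != 0 -> ThetaA A q p u = 0 ->
  (forall x, wcoef u x != 0 -> letter_count A p x = a /\ letter_count A q x = b) ->
  (b <= a)%N.
Proof.
move=> pq u0 Eu cu.
have uu : 0 < wdot u u.
  rewrite lt0r wdot_eq0 u0 /=; apply: sumr_ge0 => x _; exact: mul_conjC_ge0.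
have ThA c d : (forall x, wcoef u x != 0 -> letter_count A c x = d) ->
    ThetaA A c c u = d%:R *: u.
  move=> cd; apply: wcoefP => x; rewrite ThetaA_diag wcoefZ.
  by have [->|/cd->] := eqVneq (wcoef u x) 0; rewrite ?mulr0.
have EF : ThetaA A q p (ThetaA A p q u) = (a%:R - b%:R) *: u.
  have := ThetaA_comm A q p p q u; rewrite !eqxx !scale1r Eu.
  rewrite (ThA q b) => [|x /cu[]//]; rewrite (ThA p a) => [|x /cu[]//].
  have -> : ThetaA A p q (0 : W n) = 0.
    apply: wcoefP => x; rewrite ThetaAE wcoef0 big1 // => k _.
    by rewrite wcoef0.
  by rewrite add0r scalerBl => <-; rewrite addrK.
have : 0 <= wdot (ThetaA A p q u) (ThetaA A p q u).
  by apply: sumr_ge0 => x _; exact: mul_conjC_ge0.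
rewrite -ThetaA_adj EF /wdot.
have -> : \sum_w ((a%:R - b%:R) *: u) w * (u w)^* = (a%:R - b%:R) * wdot u u :> C.
  by rewrite mulr_sumr; apply: eq_bigr => w _; rewrite ffunE -mulrA.
by rewrite pmulr_lge0 // subr_ge0 ler_nat.
Qed.

Lemma leading_word_lattice n mu (u : W n) (w : word N n) :
  highest_weight mu u -> wcoef u w != 0 ->
  (forall x, word_lt w x -> wcoef u x = 0) ->
  forall (m : nat) (p q : 'I_N), (p < q)%N ->
    (letter_count [set k : 'I_n | (k < m)%N] q w <=
     letter_count [set k : 'I_n | (k < m)%N] p w)%N.
Proof.
move=> [uwt Eu] uw lead m p q pq; set A := [set k | _].
(* The part of u supported on the words that end like w after position m is    *)
(* killed by the raising operator on the first m positions: raising a letter   *)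
(* at a later position corresponds to a word greater than w.                   *)
pose agree (x : word N n) := [forall k : 'I_n, (m <= k)%N ==> (tnth x k == tnth w k)].
have agreeP x (k : 'I_n) : agree x -> k \notin A -> tnth x k = tnth w k.
  by move=> /forallP/(_ k)/implyP H; rewrite inE -leqNgt => /H/eqP.
pose u' : W n := [ffun x => if agree x then u x else 0].
have u'E x : wcoef u' x = if agree x then wcoef u x else 0.
  by rewrite /wcoef ffunE.
apply: (@raising_kernel_dominant _ A p q u') => [|||x].
- by apply: contraTneq pq => ->; rewrite ltnn.
- apply: contraNneq uw => u'0; have := u'E w.
  rewrite u'0 wcoef0 ifT => [<- //|]; apply/forallP => k.
  by rewrite eqxx implybT.
- apply: wcoefP => x; rewrite ThetaAE wcoef0.
  have agr k : k \in A -> agree (replace_at k q x) = agree x.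
    rewrite inE => km; apply: eq_forallb => l; rewrite tnth_replace.
    by case: (eqVneq l k) => // ->; rewrite leqNgt km.
  case xw: (agree x); last by rewrite big1 // => k /andP[/agr e _]; rewrite u'E e xw.
  transitivity (wcoef (Theta q p u) x); last by rewrite Eu // wcoef0.
  rewrite ThetaE [RHS](bigID (mem A)) /= [X in _ + X]big1 ?addr0; last first.
    move=> k /andP[/eqP xk kA]; apply: lead; apply/word_ltP; exists k.
      by rewrite tnth_replace eqxx -(agreeP x) // xk.
    move=> j kj; rewrite tnth_replace -val_eqE gtn_eqF // (agreeP x) //.
    by move: kA; rewrite !inE -!leqNgt => mk; rewrite (leq_trans mk) // ltnW.
  apply: eq_big => [k|k /andP[kA _]]; first by rewrite andbC.
  by rewrite u'E agr // xw.
- rewrite u'E; case: ifP => [xw ux|]; last by rewrite eqxx.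
  (* Total counts are fixed by the weight, and counts outside [A] by agreement with [w]. *)
  suff cA c : letter_count A c x = letter_count A c w by rewrite !cA.
  have split y : letter_count setT c y =
      (letter_count A c y + letter_count (~: A) c y)%N.
    rewrite /letter_count -(cardsID A); congr (_ + _)%N; apply: eq_card => k.
      by rewrite !inE andbC.
    by rewrite !inE andbC.
  have := weight_letter_count c uwt ux.
  rewrite -(weight_letter_count c uwt uw) !split.
  suff -> : letter_count (~: A) c x = letter_count (~: A) c w by move/addIn.
  apply: eq_card => k; rewrite !inE; case km: (k < m)%N => //=.
  by rewrite (agreeP x) // inE km.
Qed.

(** * From lattice words to standard tableaux *)

Section WordTableau.

Variables (n : nat) (mu : seq nat) (w : word N n).
Hypothesis mu_part : is_partition n mu.
Hypothesis w_weight : forall a, letter_count setT a w = nth 0%N mu a.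

Definition prefix_count (m : nat) (a : 'I_N) :=
  letter_count [set k : 'I_n | (k < m)%N] a w.

Hypothesis w_lattice : forall m (p q : 'I_N), (p < q)%N ->
  (prefix_count m q <= prefix_count m p)%N.

Lemma leq_prefix_count a m m' : (m <= m')%N ->
  (prefix_count m a <= prefix_count m' a)%N.
Proof.
move=> mm'; apply/subset_leq_card/subsetP => k; rewrite !inE => /andP[km ->].
by rewrite (leq_trans km).
Qed.

Lemma prefix_countS (x : 'I_n) a :
  prefix_count x.+1 a = (prefix_count x a + (tnth w x == a))%N.
Proof.
rewrite /prefix_count /letter_count (cardsD1 x) !inE leqnn addnC; congr (_ + _)%N.
apply: eq_card => k; rewrite !inE ltnS [RHS]andbC andbCA leq_eqVlt -val_eqE.
by case: ltngtP; rewrite ?andbT ?andbF // andbC.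
Qed.

Lemma prefix_count_lt_mu (x : 'I_n) :
  (prefix_count x (tnth w x) < nth 0 mu (tnth w x))%N.
Proof.
have : (prefix_count x.+1 (tnth w x) <= nth 0 mu (tnth w x))%N.
  rewrite -w_weight; apply/subset_leq_card/subsetP => k.
  by rewrite !inE => /andP[].
by rewrite prefix_countS eqxx addn1.
Qed.

Lemma prefix_count_lt (x : 'I_n) : (prefix_count x (tnth w x) < n)%N.
Proof. exact: leq_trans (prefix_count_lt_mu x) (partition_nth_leq _ mu_part). Qed.

(** The usual bijection: entry [x] goes to the row named by its letter, in the first column still
    free there. *)
Definition word_tableau : tableau N n :=
  [ffun x => (tnth w x, Ordinal (prefix_count_lt x))].

Lemma tword_word_tableau : tword word_tableau = w.
Proof. by apply: eq_from_tnth => k; rewrite tnth_mktuple ffunE. Qed.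

Lemma word_tableau_row_lt (x y : 'I_n) : tnth w x = tnth w y ->
  (prefix_count x (tnth w x) < prefix_count y (tnth w y))%N -> (x < y)%N.
Proof.
move=> xy; rewrite xy; apply: contraTT; rewrite -!leqNgt.
exact: leq_prefix_count.
Qed.

Lemma word_tableau_inj : injective word_tableau.
Proof.
move=> x y; rewrite !ffunE => -[xy]; rewrite -xy => exy.
apply: val_inj; case: (ltngtP x y) => // xy_lt.
- have := leq_prefix_count (tnth w x) xy_lt.
  by rewrite prefix_countS eqxx exy addn1 ltnn.
- have := leq_prefix_count (tnth w x) xy_lt.
  by rewrite prefix_countS xy eqxx -xy exy addn1 ltnn.
Qed.

Lemma word_tableau_shape : has_shape mu word_tableau.
Proof.
apply/andP; split; first exact/injectiveP/word_tableau_inj.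
apply/forallP => -[r c] /=; apply/eqP; apply/idP/idP => [/codomP[x]|c_lt].
  by rewrite ffunE => -[-> /(congr1 val)/= ->]; apply: prefix_count_lt_mu.
pose X := [set x in [set: 'I_n] | tnth w x == r].
pose Y := [set c : 'I_n | (c < nth 0 mu r)%N].
have sub : (fun x => (word_tableau x).2) @: X \subset Y.
  apply/subsetP => _ /imsetP[x + ->]; rewrite !inE ffunE => /eqP <- /=.
  exact: prefix_count_lt_mu.
have inj : {in X &, injective (fun x => (word_tableau x).2)}.
  move=> x y; rewrite !inE => /eqP xr /eqP yr exy; apply: word_tableau_inj.
  by rewrite [LHS]surjective_pairing exy [in LHS]ffunE /= xr -yr !ffunE.
have : c \in (fun x => (word_tableau x).2) @: X.
  suff /eqP-> : (fun x => (word_tableau x).2) @: X == Y by rewrite inE.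
  rewrite eqEcard sub /= card_in_imset // card_ord_lt ?(partition_nth_leq _ mu_part) //.
  by rewrite -w_weight.
case/imsetP => x; rewrite !inE => /eqP <- ->; apply/codomP; exists x.
by rewrite [RHS]surjective_pairing ffunE.
Qed.

Lemma word_tableau_standard : standard word_tableau.
Proof.
apply/forallP => x; apply/forallP => y; rewrite !ffunE /=; apply/andP; split.
  by apply/implyP => /andP[/eqP xy]; apply: word_tableau_row_lt.
apply/implyP => /andP[/eqP/(congr1 val) /= exy xy]; rewrite ltnNge; apply/negP => yx.
have yx' : (y < x)%N.
  by rewrite ltn_neqAle yx andbT; apply: contraTneq xy => /val_inj ->; rewrite ltnn.
(* Just after [y], the letter of the lower row would have occurred once more than that of the upper
   row. *)
have := w_lattice y.+1 xy; rewrite prefix_countS eqxx -exy addn1.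
by rewrite ltnNge leq_prefix_count.
Qed.

End WordTableau.

(* Induction on the greatest word w of v: w comes from a standard tableau t,   *)
(* and w is also the greatest word of w_t, with coefficient 1.                 *)
Lemma highest_weight_specht n mu (v : W n) : is_partition n mu ->
  highest_weight mu v -> v \in specht C N n mu.
Proof.
move=> mu_part.
suff H r (u : W n) : highest_weight mu u ->
    (forall x, wcoef u x != 0 -> (word_rank x < r)%N) -> u \in specht C N n mu.
  move=> /H; apply => x _; exact: (leq_ltn_trans (max_card _) (leqnn #|word N n|.+1)).
elim: r u => [|r IH] u hu ur.
  suff -> : u = 0 by apply: mem0v.
  by apply: wcoefP => x; rewrite wcoef0; apply/eqP; apply: contraT => /ur.
have [/existsP[w /andP[uw /eqP wr]]|/existsPn nr] :=
    boolP [exists w, (wcoef u w != 0) && (word_rank w == r)]; last first.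
  apply: IH => // x ux; have := ur x ux; rewrite ltnS leq_eqVlt => /orP[xr|//].
  by have := nr x; rewrite ux xr.
have lead x : word_lt w x -> wcoef u x = 0.
  move=> /word_rank_lt wx; apply/eqP; apply: contraTT wx => /ur.
  by rewrite wr -leqNgt ltnS.
have ww a : letter_count setT a w = nth 0%N mu a.
  by apply: weight_letter_count uw; case: hu.
have lat := leading_word_lattice hu uw lead.
pose t := word_tableau mu_part ww.
have t_sh : has_shape mu t by exact: word_tableau_shape.
have t_std : standard t by exact: word_tableau_standard.
have tw : tword t = w by exact: tword_word_tableau.
have [twt tE] := highest_weight_specht_vec mu_part t_sh.
rewrite -[u](subrK (wcoef u w *: specht_vec C t)) rpredD //; last first.
  apply/memvZ/memv_span/mapP; exists t => //; rewrite mem_enum inE.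
  by rewrite t_sh t_std.
case: (hu) => uwt uE; apply: IH.
  split=> [a|p q pq].
    by rewrite linearB linearZ /= uwt twt scalerBr !scalerA mulrC.
  by rewrite linearB linearZ /= uE // tE // scaler0 subrr.
move=> x; rewrite wcoefD -scaleNr wcoefZ => ux.
have xw : x != w.
  apply: contraNneq ux => ->.
  by rewrite -{3}tw (wcoef_specht_vec_tword t_sh) mulr1 subrr.
have [x0|/ur] := eqVneq (wcoef u x) 0.
  rewrite -wr; apply: word_rank_lt; rewrite -tw.
  apply: (wcoef_specht_vec_lt t_sh t_std); last by rewrite tw.
  by apply: contraNneq ux => ->; rewrite x0 mulr0 addr0.
rewrite ltnS leq_eqVlt => /orP[/eqP xr|//].
(* The order is total, so distinct words have distinct ranks. *)
by case/orP: (word_lt_total xw) => /word_rank_lt; rewrite xr wr ltnn.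
Qed.

(** * The lifting operators *)

Fact R2R_is_linear n : linear (@R2R C N n).
Proof.
case: n => [|n] a u v /=; first by rewrite scaler0 addr0.
rewrite scaler_sumr -big_split; apply: eq_bigr => b _.
by rewrite !linearP.
Qed.

HB.instance Definition _ n :=
  GRing.isLinear.Build C (W n) (W n) *:%R (@R2R C N n) (@R2R_is_linear n).

#[local] Arguments R2R {C N n} : simpl never.

Lemma wdotB n (u v w : W n) : wdot (u - v) w = wdot u w - wdot v w.
Proof.
rewrite !wdotE -sumrB; apply: eq_bigr => x _.
by rewrite wcoefD -scaleN1r wcoefZ mulN1r mulrDl mulNr.
Qed.

Lemma wdot_suml n (I : Type) (r : seq I) (P : pred I) (F : I -> W n) w :
  wdot (\sum_(j <- r | P j) F j) w = \sum_(j <- r | P j) wdot (F j) w.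
Proof.
rewrite wdotE exchange_big; apply: eq_bigr => x _.
by rewrite wcoef_sum mulr_suml.
Qed.

Lemma lowering_orthogonal n mu (i : 'I_N) (Y : 'I_N -> W n) u :
  highest_weight mu u -> wdot (\sum_(b < N | (b < i)%N) Theta b i (Y b)) u = 0.
Proof.
case=> _ uE; rewrite wdot_suml big1 // => b bi.
by rewrite Theta_adj uE // wdotE big1 // => x _; rewrite wcoef0 rmorph0 mulr0.
Qed.

Lemma Theta_chain_rcons n (p q : 'I_N) s (v : W n) :
  Theta_chain p (rcons s q) v = Theta (last p s) q (Theta_chain p s v).
Proof. by elim: s p v => //= r s IH p v; rewrite IH. Qed.

Lemma sh_chain_rcons n (a m : 'I_N) s (v : W n) :
  sh_chain (rcons (rcons s a) m) v = Theta a m (sh_chain (rcons s a) v).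
Proof.
by case: s => [|b s] //=; rewrite Theta_chain_rcons last_rcons.
Qed.

Lemma sorted_rcons2 (T : Type) (e : rel T) s a m :
  sorted e (rcons (rcons s a) m) = sorted e (rcons s a) && e a m.
Proof.
by case: s => [|b s] /=; rewrite ?andbT // rcons_path last_rcons.
Qed.

(** * Chain sums *)

Section Chains.

Variables (n : nat) (la : seq nat) (v : W n) (x : C).
Hypothesis v_hw : highest_weight la v.

(* x stands for la_i - i; keeping it free allows an induction on m, where m is  *)
(* the last letter of the chains.                                              *)
Local Notation d b := (x - shifted_part C la b).

Definition chain_term t (m : 'I_N) : W n.+1 :=
  \sum_(b : t.-tuple 'I_N | sorted (fun y z : 'I_N => y < z)%N (rcons b m))
    (\prod_(j < t) (d (tnth b j))^-1) *: sh_chain (rcons b m) v.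

Lemma chain_term0 m : chain_term 0 m = sh m v.
Proof.
rewrite /chain_term (big_pred1 [tuple]) => [|b]; last by rewrite [b]tuple0 /= eqxx.
by rewrite big_ord0 scale1r.
Qed.

(** Splits off the last letter before [m], which is applied last. *)
Lemma chain_termS t m : chain_term t.+1 m =
  \sum_(b < N | (b < m)%N) (d b)^-1 *: Theta b m (chain_term t b).
Proof.
pose h (p : 'I_N * t.-tuple 'I_N) := [tuple of rcons p.2 p.1].
have h_bij : bijective h.
  apply: inj_card_bij; last by rewrite card_prod !card_tuple card_ord expnS.
  move=> [a s] [b s'] /(congr1 val)/rcons_inj[ss' ab].
  by rewrite (val_inj ss') ab.
rewrite /chain_term (reindex h) /=; last exact: onW_bij.
transitivity (\sum_(b < N | (b < m)%N) \sum_(s : t.-tuple 'I_N |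
    sorted (fun y z : 'I_N => y < z)%N (rcons s b))
    (\prod_(j < t.+1) (d (tnth (h (b, s)) j))^-1) *:
       sh_chain (rcons (rcons s b) m) v).
  rewrite pair_big_dep /=; apply: eq_big => [[b s]|[b s] _] //=.
  by rewrite sorted_rcons2 andbC.
apply: eq_bigr => b _; rewrite [Theta b m _]linear_sum scaler_sumr.
apply: eq_bigr => s _.
rewrite linearZ scalerA sh_chain_rcons; congr (_ *: _).
rewrite -(big_tuple _ _ (h (b, s)) xpredT (fun y => (d y)^-1)).
rewrite -(big_tuple _ _ s xpredT (fun y => (d y)^-1)).
by rewrite /= -cats1 big_cat big_seq1 mulrC.
Qed.

Lemma chain_term_eq0 t (m : 'I_N) : (m < t)%N -> chain_term t m = 0.
Proof.
elim: t m => [|t IH] m // mt; rewrite chain_termS big1 // => b bm.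
by rewrite IH ?linear0 ?scaler0 // (leq_trans bm).
Qed.

Definition lift_vec m := \sum_(t < N) chain_term t m.

Lemma lift_vecE m : lift_vec m =
  sh m v + \sum_(b < N | (b < m)%N) (d b)^-1 *: Theta b m (lift_vec b).
Proof.
have N_gt0 : (0 < N)%N by apply: leq_ltn_trans (ltn_ord m).
rewrite {1}/lift_vec -(big_mkord xpredT (chain_term^~ m)) big_ltn // chain_term0.
congr (_ + _); rewrite big_add1.
under eq_bigr do rewrite chain_termS.
rewrite exchange_big; apply: eq_bigr => b bm /=.
rewrite -scaler_sumr -linear_sum; congr (_ *: Theta _ _ _).
rewrite /lift_vec -(big_mkord xpredT (chain_term^~ b)).
(* The shift of [t] loses the length N - 1 term of [lift_vec b]; it vanishes because
   [b < m <= N - 1]. *)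
rewrite [RHS](@big_cat_nat _ _ _ N.-1) ?leq_pred //=.
rewrite [X in _ = _ + X]big_nat_cond [X in _ = _ + X]big1 ?addr0 // => t.
case/andP=> /andP[Nt _] _.
by apply: chain_term_eq0; rewrite (leq_trans bm) // (leq_trans _ Nt) // -ltnS prednK.
Qed.

Lemma weight_sh m a :
  Theta a a (sh m v) = ((nth 0%N la a)%:R + (a == m)%:R) *: sh m v.
Proof.
case: v_hw => v_wt _; rewrite Theta_sh v_wt linearZ scalerDl.
by case: eqP => [->|_]; rewrite ?scale0r.
Qed.

Lemma weight_lift_vec m a :
  Theta a a (lift_vec m) = ((nth 0%N la a)%:R + (a == m)%:R) *: lift_vec m.
Proof.
have [k] := ubnP (m : nat); elim: k m => // k IH m; rewrite ltnS => mk.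
rewrite lift_vecE [Theta a a _]linearD /= weight_sh scalerDr; congr (_ + _).
rewrite [Theta a a _]linear_sum scaler_sumr; apply: eq_bigr => b bm.
rewrite linearZ /= !scalerA mulrC -scalerA; congr (_ *: _).
have := Theta_comm a a b m (lift_vec b).
rewrite (IH b) ?(leq_trans bm) // linearZ /= => /(canRL (addrK _)) ->.
have -> : (a == m)%:R *: Theta b a (lift_vec b) = (a == m)%:R *: Theta b m (lift_vec b).
  by case: eqP => [->|]; rewrite ?scale0r.
have -> : (a == b)%:R *: Theta a m (lift_vec b) = (a == b)%:R *: Theta b m (lift_vec b).
  by case: eqP => [->|]; rewrite ?scale0r.
by rewrite -scalerDl -scalerBl; congr (_ *: _); ring.
Qed.

Lemma card_between (p m : 'I_N) : (p < m)%N ->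
  #|[set b : 'I_N | (b < m)%N && (p < b)%N]| = (m - p.+1)%N.
Proof.
move=> pm; rewrite -{2}(card_ord_lt (ltnW (ltn_ord m))).
rewrite -{2}(card_ord_lt (ltn_ord p)) -cardsDS.
  by apply: eq_card => b; rewrite !inE -leqNgt andbC.
by apply/subsetP => b; rewrite !inE ltnS => /leq_ltn_trans; apply.
Qed.

(* At m = i and x = la_i - i the coefficient vanishes. *)
Lemma Theta_lift_vec (m p q : 'I_N) :
  (forall b : 'I_N, (b < m)%N -> x != shifted_part C la b) -> (p < q)%N ->
  Theta q p (lift_vec m) =
    if q == m then (d m / d p) *: lift_vec p else 0.
Proof.
have [k] := ubnP (m : nat); elim: k m p q => // k IH m p q; rewrite ltnS => mk x_neq pq.
have d_neq0 (b : 'I_N) : (b < m)%N -> d b != 0 by move/x_neq; rewrite subr_eq0.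
have IHb (b p' q' : 'I_N) : (b < m)%N -> (p' < q')%N ->
    Theta q' p' (lift_vec b) = if q' == b then (d b / d p') *: lift_vec p' else 0.
  move=> bm pq'; apply: IH pq' => [|c cb]; first exact: leq_trans bm mk.
  by apply: x_neq; apply: ltn_trans bm.
have expand : Theta q p (lift_vec m) = (q == m)%:R *: sh p v +
    (\sum_(b < N | (b < m)%N) (d b)^-1 *: Theta b m (Theta q p (lift_vec b))
     + (q == m)%:R *: \sum_(b < N | (b < m)%N) (d b)^-1 *: Theta b p (lift_vec b)
     - (if (p < m)%N then (d p)^-1 *: Theta q m (lift_vec p) else 0)).
  rewrite {1}lift_vecE [Theta q p _]linearD /= Theta_sh (proj2 v_hw) // linear0 add0r.
  congr (_ + _); rewrite [Theta q p _]linear_sum /=.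
  have -> : (if (p < m)%N then (d p)^-1 *: Theta q m (lift_vec p) else 0) =
      \sum_(b < N | (b < m)%N) (d b)^-1 *: ((p == b)%:R *: Theta q m (lift_vec b)).
    case: ifP => pm.
      rewrite (bigD1 p) //= eqxx scale1r big1 ?addr0 // => b /andP[_].
      by rewrite eq_sym => /negPf ->; rewrite scale0r scaler0.
    rewrite big1 // => b bm; case: eqP => [pb|]; last by rewrite scale0r scaler0.
    by rewrite pb bm in pm.
  rewrite scaler_sumr -big_split -sumrB; apply: eq_bigr => b _.
  rewrite linearZ /= scalerA [_%:R * _]mulrC -scalerA -scalerDr -scalerBr.
  congr (_ *: _); rewrite -(Theta_comm q p b m) addrK //.
rewrite expand; case: (ltngtP q m) => qm.
(* Only [b = q] survives, with coefficient [(d q)^-1 * (d q / d p)], and cancels the last term. *)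
- have pm := ltn_trans pq qm.
  have -> : (q == m) = false by apply: contraTF qm => /eqP ->; rewrite ltnn.
  rewrite !scale0r add0r addr0 pm (bigD1 q) //= big1 => [|b /andP[bm bq]].
    rewrite IHb // eqxx linearZ /= scalerA mulrA mulVf ?d_neq0 // mul1r.
    by rewrite addr0 subrr.
  by rewrite IHb // eq_sym (negPf bq) linear0 scaler0.
- have -> : (q == m) = false by apply: contraTF qm => /eqP ->; rewrite ltnn.
  rewrite !scale0r add0r addr0 big1 => [|b bm].
    case: ifP => pm; last by rewrite subrr.
    rewrite IHb // ; have -> : (q == p) = false.
      by apply: contraTF pq => /eqP ->; rewrite ltnn.
    by rewrite scaler0 subrr.
  rewrite IHb //; have -> : (q == b) = false.
    by apply: contraTF (ltn_trans bm qm) => /eqP ->; rewrite ltnn.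
  by rewrite linear0 scaler0.
- have {}qm : q = m by apply: val_inj.
  (* The [sh] term and the terms with [b < p] form [lift_vec p]. The term [b = p] adds (la_p + 1) /
     d_p, each of the m - p - 1 letters strictly between adds 1 / d_p, and the last term subtracts
     la_m / d_p. The total is d_m / d_p. *)
  subst q; rewrite eqxx !scale1r pq.
  rewrite [X in _ + (X + _ - _)]big1 => [|b bm]; last first.
    rewrite IHb //; have -> : (m == b) = false.
      by apply: contraTF bm => /eqP ->; rewrite ltnn.
    by rewrite linear0 scaler0.
  rewrite add0r weight_lift_vec.
  have -> : (m == p) = false by apply: contraTF pq => /eqP ->; rewrite ltnn.
  rewrite (bigID (fun b : 'I_N => (b < p)%N)) /=.
  rewrite [X in _ + (X + _ - _)](eq_bigl (fun b : 'I_N => (b < p)%N)); last first.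
    by move=> b; apply: andb_idl => /ltn_trans; apply.
  rewrite !addrA -lift_vecE (bigD1 p) /=; last by rewrite pq ltnn.
  rewrite weight_lift_vec eqxx.
  rewrite (eq_bigr (fun=> (d p)^-1 *: lift_vec p)); last first.
    move=> b /andP[/andP[bm]]; rewrite -leqNgt leq_eqVlt eq_sym val_eqE => /orP[->//|pb] _.
    by rewrite IHb // eqxx scalerA mulrA mulVf ?d_neq0 // mul1r.
  rewrite sumr_const (_ : #|_| = (m - p.+1)%N); last first.
    rewrite -(card_between pq); apply: eq_card => b.
    rewrite inE unfold_in /= (ltn_neqAle p b) -leqNgt -andbA.
    by rewrite [(p <= b)%N && _]andbC (eq_sym b).
  rewrite -scaler_nat !scalerA -{1}[lift_vec p]scale1r -!scalerDl -scalerBl.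
  congr (_ *: _); rewrite natrB // /shifted_part.
  have := d_neq0 p pq; rewrite /shifted_part; set y := nth _ la p; set z := nth _ la m.
  rewrite -!natr1; move=> dp.
  by field.
Qed.

End Chains.

(** The numbers la_k - k strictly decrease, so no denominator vanishes. *)
Lemma shifted_part_neq n la (i b : 'I_N) : is_partition n la -> (b < i)%N ->
  shifted_part C la i != shifted_part C la b.
Proof.
move=> la_part bi; have := partition_leq_nth la_part (ltnW bi).
rewrite /shifted_part -subr_eq0 => lab.
have -> : (nth 0%N la i)%:R - i.+1%:R - ((nth 0%N la b)%:R - b.+1%:R) =
    (nth 0%N la i + b.+1)%:R - (nth 0%N la b + i.+1)%:R :> C by rewrite !natrD; ring.
by rewrite subr_eq0 eqr_nat; lia.
Qed.

(** * The chain sum as projection and as eigenvector *)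

Section Main.

Variables (n : nat) (la : seq nat) (i : 'I_N) (v : W n).
Hypotheses (la_part : is_partition n la) (mu_part : is_partition n.+1 (incr_nth la i)).
Hypothesis v_specht : v \in specht C N n la.

Let v_hw : highest_weight la v := specht_highest_weight la_part v_specht.
Local Notation x := (shifted_part C la i).
Local Notation Z := (lift_vec la v x).

Lemma nth_incr (a : 'I_N) :
  (nth 0%N (incr_nth la i) a)%:R = (nth 0%N la a)%:R + (a == i)%:R :> C.
Proof. by rewrite nth_incr_nth natrD addrC eq_sym. Qed.

Lemma highest_weight_lift : highest_weight (incr_nth la i) (Z i).
Proof.
split=> [a|p q pq]; first by rewrite (weight_lift_vec x v_hw) nth_incr.
rewrite (Theta_lift_vec v_hw) //; last by move=> b; apply: (shifted_part_neq la_part).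
by case: eqP => // _; rewrite subrr mul0r scale0r.
Qed.

Lemma sh_sub_lift : sh i v - Z i = \sum_(b < N | (b < i)%N)
  Theta b i (- (x - shifted_part C la b)^-1 *: Z b).
Proof.
rewrite lift_vecE opprD addNKr -sumrN; apply: eq_bigr => b _.
by rewrite [RHS]linearZ /= scaleNr.
Qed.

Lemma Lmap_lift : Lmap la i v = Z i.
Proof.
have sub_M : (specht C N n.+1 (incr_nth la i) <= Mspace C N n.+1 (incr_nth la i))%VS.
  by apply/subvP => u /(specht_highest_weight mu_part)[/memMP].
have sh_M : sh i v \in Mspace C N n.+1 (incr_nth la i).
  by apply/memMP => a; rewrite (weight_sh v_hw) nth_incr.
have [P_S P_orth] := orth_projP sub_M sh_M; rewrite -/(Lmap la i v) in P_S P_orth.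
have Z_S := highest_weight_specht mu_part highest_weight_lift.
have D_S : Z i - Lmap la i v \in specht C N n.+1 (incr_nth la i) by rewrite rpredB.
apply/esym/eqP; rewrite -subr_eq0 -wdot_eq0; apply/eqP.
rewrite {1}(_ : Z i - Lmap la i v = (sh i v - Lmap la i v) - (sh i v - Z i)); last first.
  by rewrite opprB [RHS]addrC addrA subrK.
rewrite wdotB P_orth // sh_sub_lift.
by rewrite (lowering_orthogonal _ _ (specht_highest_weight mu_part D_S)) subrr.
Qed.

Lemma R2R_lift eps : R2R v = eps *: v ->
  R2R (Z i) = (eps + n.+1%:R + (nth 0%N la i).+1%:R - i.+1%:R) *: Z i.
Proof.
case: (v_hw) => v_wt v_raise v_eig.
set c := (X in X *: _).
(* In the sum from [R2R_sh], letters above [i] give 0, [i] itself gives la_i, and moving [Theta b i]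
   outside costs one [sh i v] for each letter below [i]. Counting letters from 0 there are [i] of
   these, which yields [c]. *)
have R2R_sh_i : R2R (sh i v) =
    c *: sh i v + \sum_(b < N | (b < i)%N) Theta b i (sh b v).
  have not_lt : \sum_(b < N | ~~ (b < i)%N) sh b (Theta b i v) =
      (nth 0%N la i)%:R *: sh i v.
    rewrite (bigD1 i) ?ltnn //= v_wt linearZ big1 ?addr0 // => b /andP[].
    rewrite -leqNgt leq_eqVlt eq_sym val_eqE => /orP[->//|ib] _.
    by rewrite v_raise // linear0.
  have lt : \sum_(b < N | (b < i)%N) sh b (Theta b i v) =
      \sum_(b < N | (b < i)%N) Theta b i (sh b v) - i%:R *: sh i v.
    rewrite scaler_nat -[X in _ *+ X](card_ord_lt (ltnW (ltn_ord i))) cardsE.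
    rewrite -sumr_const -sumrB; apply: eq_bigr => b _.
    by rewrite Theta_sh eqxx scale1r addrK.
  rewrite R2R_sh v_eig linearZ /= (bigID (fun b : 'I_N => (b < i)%N)) /= lt not_lt.
  rewrite [RHS]addrC -!addrA addrCA -scaleNr -!scalerDl; congr (_ + _ *: _).
  by rewrite /c -!natr1; ring.
have D_low : R2R (Z i) - c *: Z i = \sum_(b < N | (b < i)%N) Theta b i
    (sh b v + (x - shifted_part C la b)^-1 *: (R2R (Z b) - c *: Z b)).
  rewrite {1 2}lift_vecE [R2R _]linearD /= R2R_sh_i scalerDr opprD addrACA.
  rewrite [c *: _ + _]addrC addrK [R2R _]linear_sum scaler_sumr -sumrB -big_split.
  apply: eq_bigr => b _; rewrite [RHS]linearD; congr (_ + _).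
  rewrite [X in X - _ = _]linearZ /= R2R_Theta scalerA mulrC -scalerA -scalerBr.
  by rewrite [RHS]linearZ /= [Theta b i (_ - _)]linearB /= [Theta b i (c *: _)]linearZ.
have [Z_wt Z_raise] := highest_weight_lift.
have D_hw : highest_weight (incr_nth la i) (R2R (Z i) - c *: Z i).
  split=> [a|p q pq]; rewrite linearB linearZ /= -R2R_Theta.
    by rewrite Z_wt linearZ /= scalerBr !scalerA mulrC.
  by rewrite Z_raise // linear0 scaler0 subrr.
apply/eqP; rewrite -subr_eq0 -wdot_eq0 {1}D_low.
by rewrite (lowering_orthogonal _ _ D_hw).
Qed.

End Main.
End Words.

Theorem theorem21 (R : realType) (N n : nat) (la : seq nat) (i : 'I_N) :
  (size la < N)%N ->
  is_partition n la ->
  (i <= size la)%N ->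
  is_partition n.+1 (incr_nth la i) ->
  (forall (v : wspace R[i] N n) (eps : R[i]),
     v \in specht R[i] N n la ->
     is_eigenvector (@R2R R[i] N n) eps v ->
     Lmap la i v != 0 ->
     is_eigenvector (@R2R R[i] N n.+1)
       (eps + n.+1%:R + (nth 0%N la i).+1%:R - i.+1%:R) (Lmap la i v))
  /\
  (forall v : wspace R[i] N n,
     v \in specht R[i] N n la -> Lmap la i v = chain_sum la i v).
Proof.
move=> _ la_part _ mu_part; split=> [v eps vS [_ v_eig] Lv0|v vS].
  by split=> //; rewrite Lmap_lift //; apply: R2R_lift.
by rewrite Lmap_lift.
Qed.
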